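(* Let $n=2^k$ with $k\ge 1$, and let $Q_n=\langle a,b \mid a^{2n}=e,\ b^2=a^n,\ ab=ba^{-1}\rangle$ be the generalized quaternion group of order $4n$. Let $\mathcal{P}(Q_{n}^{*})$ be its proper power graph (on $4n-1$ vertices). Then: (i) the distance Laplacian characteristic polynomial of $\mathcal{P}(Q_{n}^{*})$ is, up to the sign $(-1)^{4n-1}$, \[ x(x-4n+1)(x-6n+1)^{2n-3}(x-8n+5)^{n}(x-8n+3)^{n}; \] (ii) the Laplacian characteristic polynomial of $\mathcal{P}(Q_{n}^{*})$ is, up to the sign $(-1)^{4n-1}$, \[ x(x-3)^{n}(x-1)^{n}(x-4n+1)(x-2n+1)^{2n-3}. \] Equivalently, $\det(xI-D^L)$ and $\det(xI-L)$ equal these polynomials, respectively.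
   Context: The (undirected) power graph $\mathcal{P}(\mathcal{G})$ of a finite group $\mathcal{G}$ has vertex set $\mathcal{G}$, and two distinct elements $x,y$ are adjacent iff $y=x^{i}$ or $x=y^{j}$ for some positive integers $i,j$. The proper power graph $\mathcal{P}(\mathcal{G}^* )$ is the induced subgraph of $\mathcal{P}(\mathcal{G})$ on $\mathcal{G}\setminus\{e\}$, $e$ the identity. The Laplacian matrix is $L=\mathrm{Deg}-A$ ($A$ adjacency matrix, $\mathrm{Deg}$ diagonal degree matrix). For a connected graph with vertices $v_1,\dots,v_m$, $D=(d(v_i,v_j))$ is the distance matrix, $Tr(v_i)=\sum_j d(v_i,v_j)$, and the distance Laplacian matrix is $D^L=\mathrm{diag}(Tr(v_1),\dots,Tr(v_m))-D$. The paper defines the (distance) Laplacian characteristic polynomial as $\det(M-xI)$ for $M=L$ (resp. $D^L$). *)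

(* Defs.v *)
From mathcomp Require Import all_boot all_order all_algebra.
From mathcomp Require Import all_fingroup all_solvable.

Set Implicit Arguments.
Unset Strict Implicit.
Unset Printing Implicit Defensive.

Import GRing.Theory.
Local Open Scope ring_scope.

Section Graphs.

Variables (V : finType) (e : rel V).

Definition walk (k : nat) (x y : V) : bool :=
  [exists p : k.-tuple V, path e x p && (last x p == y)].

(* The length of a shortest walk from x to y. A shortest walk visits no vertex
   twice, so only the lengths below #|V| are searched; the value is #|V| when
   y is not reachable from x. See gdistP. *)
Definition gdist (x y : V) : nat := find (fun k => walk k x y) (iota 0 #|V|).

Lemma gdistP x y : connect e x y ->
  (exists p, [/\ path e x p, last x p = y & size p = gdist x y]) /\
  (forall p, path e x p -> last x p = y -> (gdist x y <= size p)%N).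
Proof.
move=> /connectP[p0 ep0 y_p0].
have walkP p : path e x p -> last x p = y -> walk (size p) x y.
  by move=> ep py; apply/existsP; exists (in_tuple p); rewrite ep py eqxx.
have short p : path e x p -> last x p = y ->
    exists q, [/\ path e x q, last x q = y, size q <= size p
                & size q < #|V|]%N.
  move=> ep py; case: (shortenP ep) py => q eq uq sub_qp qy.
  exists q; split=> //.
    by case/andP: uq => _ uq; apply: uniq_leq_size.
  by have := max_card (mem (x :: q)); rewrite (card_uniqP uq).
have has_w : has (fun k => walk k x y) (iota 0 #|V|).
  have [q [eq qy _ ltq]] := short _ ep0 (esym y_p0).
  by apply/hasP; exists (size q); rewrite ?walkP // mem_iota.
have lt_d : (gdist x y < #|V|)%N by rewrite /gdist -{2}(size_iota 0 #|V|) -has_find.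
split=> [|p ep py].
  have := nth_find 0%N has_w; rewrite -/(gdist x y) nth_iota //.
  case/existsP=> p /andP[ep /eqP py]; exists p; split=> //.
  by rewrite size_tuple.
have [q [eq qy leqp ltq]] := short _ ep py.
apply: leq_trans leqp; rewrite leqNgt; apply/negP => lt_q_d.
by have := before_find 0%N lt_q_d; rewrite nth_iota // walkP.
Qed.

Definition deg (x : V) : nat := #|[set y | e x y]|.

Definition transmission (x : V) : nat := \sum_(y : V) gdist x y.

(* Matrices are indexed by 'I_#|V| through the enumeration enum_val of V. *)
Definition adjacency_mx : 'M[int]_#|V| :=
  \matrix_(i, j) (e (enum_val i) (enum_val j))%:R.

Definition degree_mx : 'M[int]_#|V| := diag_mx (\row_i (deg (enum_val i))%:R).

Definition laplacian_mx : 'M[int]_#|V| := degree_mx - adjacency_mx.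

Definition distance_mx : 'M[int]_#|V| :=
  \matrix_(i, j) (gdist (enum_val i) (enum_val j))%:R.

Definition transmission_mx : 'M[int]_#|V| :=
  diag_mx (\row_i (transmission (enum_val i))%:R).

Definition distance_laplacian_mx : 'M[int]_#|V| :=
  transmission_mx - distance_mx.

End Graphs.

(* det (M - x I), as opposed to the library's char_poly M = det (x I - M). *)
Definition char_poly_sub (R : comNzRingType) (m : nat) (M : 'M[R]_m) :
    {poly R} :=
  \det (map_mx polyC M - 'X%:M).

Section PowerGraph.

Variable gT : finGroupType.

(* y is a power of x with positive exponent; exponents 1, ..., #|gT| exhaust
   the powers of x. *)
Definition pos_power (x y : gT) : bool :=
  [exists i : 'I_#|gT|, y == (x ^+ i.+1)%g].

Lemma pos_powerP x y :
  reflect (exists2 i, (0 < i)%N & y = (x ^+ i)%g) (pos_power x y).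
Proof.
apply: (iffP existsP) => [[i /eqP->] | [i i_gt0 ->]]; first by exists i.+1.
have lt_i : (i.-1 %% #[x]%g < #|gT|)%N.
  by apply: leq_trans (ltn_pmod _ (order_gt0 x)) (max_card _).
exists (Ordinal lt_i); rewrite -{1}(prednK i_gt0) !expgS /=.
by rewrite expg_mod_order.
Qed.

Definition power_adj : rel gT :=
  fun x y => (x != y) && (pos_power x y || pos_power y x).

Definition induced (S : {set gT}) (e : rel gT) : rel {x : gT | x \in S} :=
  fun u v => e (val u) (val v).

(* G^# is G minus the identity. *)
Definition proper_power_graph (G : {group gT}) : rel {x : gT | x \in G^#%g} :=
  induced power_adj.

End PowerGraph.

Arguments proper_power_graph {gT} G.

(* Main.v *)
(** In the proper power graph of [Q], the involution [z = a ^+ n] is adjacent to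
    every other vertex, and removing it leaves a disjoint union of cliques: the
    rest of the cyclic 2-group [<[a]>], and the pairs [{t, t^-1}] with [t] outside
    [<[a]>], which all have order 4.

    Let [U] be the vertex-clique incidence matrix, with [z] added to each clique.
    Then [x - L = E + U U^T] with [E] diagonal, and [det (1 + A B) = det (1 + B A)]
    reduces the determinant to that of a diagonal matrix plus a constant one,
    where the same identity applies again. The entries of [E] have to be
    invertible, so [x] is taken in a field, away from the integers; the indeterminate
    in the fraction field of [int[X]] is such an element.

    As the graph has diameter 2, the distance Laplacian is [2 m - 2 J - L], with [J]
    the all-one matrix and [m] the number of vertices, and [L J = 0] relates its
    characteristic polynomial at [x] to that of [L] at [2 m - x]. *)
Require Import Defs.
From mathcomp Require Import all_boot all_order all_algebra.
From mathcomp Require Import all_fingroup all_solvable.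
From mathcomp Require Import zify ring.

Set Implicit Arguments.
Unset Strict Implicit.
Unset Printing Implicit Defensive.

Import GRing.Theory.

(** * Determinants of low-rank perturbations *)

Section Determinants.

Local Open Scope ring_scope.

(** Both sides are the determinant of the block matrix [M]: right multiplication by a block
    unitriangular matrix clears its lower left or its upper right block. *)
Lemma det_add1_mulC (R : comNzRingType) m n (A : 'M[R]_(m, n)) (B : 'M_(n, m)) :
  \det (1%:M + A *m B) = \det (1%:M + B *m A).
Proof.
pose M := block_mx 1%:M (- A) B 1%:M.
transitivity (\det M).
  have: M *m block_mx 1%:M 0 (- B) 1%:M = block_mx (1%:M + A *m B) (- A) 0 1%:M.
    by rewrite mulmx_block !mulmx1 !mul1mx !mulmx0 !add0r mulNmx mulmxN opprK addrN.
  move/(congr1 determinant); rewrite det_mulmx det_lblock det_ublock !det1.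
  by rewrite !mulr1 => ->.
have: M *m block_mx 1%:M A 0 1%:M = block_mx 1%:M 0 B (1%:M + B *m A).
  by rewrite mulmx_block !mulmx1 !mul1mx !mulmx0 !addr0 addrN [B *m A + _]addrC.
move/(congr1 determinant); rewrite det_mulmx det_lblock det_ublock !det1.
by rewrite !mulr1 mul1r => ->.
Qed.

Lemma det_diag_add_mul (F : fieldType) m n (d : 'rV[F]_m) (A : 'M_(m, n)) B :
  (forall i, d 0 i != 0) ->
  \det (diag_mx d + A *m B) =
    (\prod_i d 0 i) * \det (1%:M + B *m diag_mx (\row_i (d 0 i)^-1) *m A).
Proof.
move=> d_neq0; rewrite -det_diag -mulmxA -det_add1_mulC -det_mulmx mulmxDr mulmx1.
rewrite !mulmxA mulmx_diag (_ : diag_mx (\row_i _) = 1%:M) ?mul1mx //.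
by apply/matrixP=> i j; rewrite !mxE mulfV.
Qed.

(** A constant matrix is a column times a row, so the swapped determinant has size 1. *)
Lemma det_diag_add_const (F : fieldType) m (d : 'rV[F]_m) b :
  (forall i, d 0 i != 0) ->
  \det (diag_mx d + const_mx b) =
    (\prod_i d 0 i) * (1 + b * \sum_i (d 0 i)^-1).
Proof.
move=> d_neq0.
have ->: const_mx b = (const_mx b : 'cV_m) *m (const_mx 1 : 'rV_m).
  by apply/matrixP=> i j; rewrite !mxE big_ord1 !mxE mulr1.
rewrite det_diag_add_mul // det_mx11 mul_mx_diag 2!mxE mulr_sumr.
congr (_ * (_ + _)); rewrite !mxE.
by apply: eq_bigr => i _; rewrite !mxE mul1r mulrC.
Qed.

(** With [J] the all-one matrix, [M J = a J], hence [M - b J = M (1 - (b / a) J)]. *)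
Lemma det_sub_const (F : fieldType) m (M : 'M[F]_m) a b :
  a != 0 -> (forall i, \sum_j M i j = a) ->
  \det (M - const_mx b) = \det M * (1 - b * m%:R / a).
Proof.
move=> a_neq0 rowM.
have ->: M - const_mx b = M *m (diag_mx (const_mx 1) + const_mx (- (b / a))).
  rewrite diag_const_mx mulmxDr mulmx1; congr (_ + _).
  apply/matrixP=> i j; rewrite !mxE.
  under eq_bigr => l _ do rewrite mxE.
  by rewrite -mulr_suml rowM mulrN mulrC divfK.
rewrite det_mulmx det_diag_add_const => [|i]; last by rewrite mxE oner_eq0.
under eq_bigr => i _ do rewrite mxE.
under [in X in _ * (_ * X)]eq_bigr => i _ do rewrite mxE invr1.
rewrite !big_const_ord iter_mulr_1 expr1n mul1r iter_addr_0.
by rewrite mulNr mulrAC.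
Qed.

(** * Laplacian of cliques joined at a hub vertex *)

Section Fan.

Variables (V T : finType) (e : rel V) (z : V) (f : V -> T).
Hypothesis eE : forall u v, e u v = (u != v) && [|| u == z, v == z | f u == f v].

(** Off the hub, the nonempty fibres of [f] are the cliques; a value [c] with [s c = 0] names
    none. *)
Let s c := #|[set v | (v != z) && (f v == c)]|.

Lemma deg_hub : deg e z = #|V|.-1.
Proof.
rewrite -(cardsC1 z) /deg; congr #|pred_of_set _|; apply/setP=> v.
by rewrite !inE eE eqxx andbT eq_sym.
Qed.

(** The neighbour [z] makes up for [v] itself, which its class counts. *)
Lemma deg_rim v : v != z -> deg e v = s (f v).
Proof.
move=> vz; rewrite /deg /s (cardsD1 z) (cardsD1 v [set w | _ & _]) !inE eE vz !eqxx !orbT.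
congr (_ + #|pred_of_set _|)%N; apply/setP=> w; rewrite !inE eE (negPf vz) (eq_sym w v) [f w == _]eq_sym.
by case: (w == z); rewrite ?andbF.
Qed.

Lemma sum_class_sizes : (\sum_c s c = #|V|.-1)%N.
Proof.
rewrite -(cardsC1 z) -sum1_card (partition_big f predT) //=.
apply: eq_bigr => c _; rewrite /s -sum1_card.
by apply: eq_bigl => v; rewrite !inE.
Qed.

Variables (F : fieldType) (x : F).
Hypothesis x_nonint : forall i : int, x != i%:~R.

Let L : 'M[F]_#|V| := map_mx intr (laplacian_mx e).

(** Vectors supported on one clique off [z], of sum 0, have eigenvalue [s c + 1]. Vectors vanishing
    at [z], constant on each clique and of sum 0 have eigenvalue 1. One factor [x - 1] per clique is
    one too many for the latter, which the factor on the left makes up for. *)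
Lemma det_fan_laplacian :
  (x - 1) * \det (x%:M - L) =
  x * (x - #|V|%:R) *
    \prod_(c | s c != 0%N) ((x - 1) * (x - 1 - (s c)%:R) ^+ (s c).-1).
Proof.
have x_nonnat (i : nat) : x - i%:R != 0 by rewrite subr_eq0; apply: (x_nonint i).
have x1_nonnat (i : nat) : x - 1 - i%:R != 0 by rewrite -addrA -opprD -mulrS x_nonnat.
have x1_neq0 : x - 1 != 0 := x_nonnat 1%N.
pose U (v : V) (c : T) : bool := (v == z) || (f v == c).
(* The last term of [E v] is the number of cliques containing [v]. *)
pose E (v : V) : F := x - (deg e v)%:R - (\sum_c U v c)%:R.
have Ez : E z = x - #|V|.-1%:R - #|T|%:R.
  rewrite /E deg_hub (eq_bigr (fun=> 1%N)); last by move=> c _; rewrite /U eqxx.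
  by rewrite sum1_card.
have Ev v : v != z -> E v = x - 1 - (s (f v))%:R.
  move=> vz; rewrite /E deg_rim // (bigD1 (f v)) //= big1 => [|c]; last first.
    by rewrite /U (negPf vz) eq_sym => /negPf->.
  by rewrite /U eqxx orbT addrAC.
have E_neq0 v : E v != 0.
  by rewrite /E -addrA -opprD -natrD x_nonnat.
(* Distinct vertices lie together in exactly one clique if adjacent, and in none otherwise. *)
have ->: x%:M - L = diag_mx (\row_i E (enum_val i)) +
    (\matrix_(i, c) (U (enum_val i) (enum_val c))%:R) *m
      (\matrix_(c, i) (U (enum_val i) (enum_val c))%:R : 'M[F]_(#|T|, #|V|)).
  apply/matrixP=> i j; rewrite !mxE.
  under eq_bigr => c _ do rewrite !mxE -natrM mulnb.
  rewrite -(big_enum_val (A := T) (fun c => (U (enum_val i) c && U (enum_val j) c)%:R)).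
  set u := enum_val i; set v := enum_val j.
  have ->: (i == j) = (u == v) by rewrite /u /v (inj_eq enum_val_inj).
  have [<-|uv] := eqVneq u v.
    rewrite eE eqxx /= !mulr1n subr0 rmorph_nat.
    under [in RHS]eq_bigr => c _ do rewrite andbb.
    by rewrite -natr_sum /E subrK.
  rewrite !mulr0n !sub0r rmorphN opprK add0r eE uv /= rmorph_nat.
  rewrite -natr_sum /U; congr (_%:R).
  have [uz|uz] /= := eqVneq u z.
    rewrite -uz eq_sym (negPf uv) (bigD1 (f v)) //= eqxx big1 // => c.
    by rewrite eq_sym => /negPf->.
  rewrite (bigD1 (f u)) //= eqxx /= big1 => [|c]; last by rewrite eq_sym => /negPf->.
  by rewrite addn0 eq_sym [f v == _]eq_sym.
rewrite det_diag_add_mul => [|i]; last by rewrite mxE.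
pose E' c : F := x - 1 - (s c)%:R.
have E'_neq0 c : E' c != 0 by rewrite x1_nonnat.
set M := 1%:M + _.
(* The hub lies in every clique and yields the constant [(E z)^-1]. Any other vertex lies in a
   single clique and contributes to the diagonal, where [1 + s c / E' c = (x - 1) / E' c]. *)
have {M}->: M = diag_mx (\row_c ((x - 1) / E' (enum_val c))) + const_mx (E z)^-1.
  apply/matrixP=> c d; rewrite /M [LHS]mxE [X in _ + X]mxE.
  under eq_bigr => i _ do rewrite mul_mx_diag !mxE mulrAC -natrM mulnb.
  rewrite !mxE.
  rewrite -(big_enum_val (A := V) (fun i => (U i _ && U i _)%:R * (E i)^-1)).
  set a := enum_val c; set b := enum_val d.
  have ->: (c == d) = (a == b) by rewrite /a /b (inj_eq enum_val_inj).
  rewrite (bigD1 z) //= {1 2}/U eqxx mul1r addrCA [RHS]addrC; congr (_ + _).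
  have -> : \sum_(v | v != z) (U v a && U v b)%:R / E v = (s a)%:R / E' a *+ (a == b).
    rewrite /s; have [<-|ab] := eqVneq a b; last first.
      rewrite mulr0n big1 // => v vz; rewrite /U (negPf vz) /=.
      have [->|] := eqVneq (f v) a; last by rewrite mul0r.
      by rewrite (negPf ab) mul0r.
    rewrite mulr1n -sum1_card natr_sum mulr_suml big_mkcond [RHS]big_mkcond /=.
    apply: eq_bigr => v _; rewrite inE; have [//|vz] := eqVneq v z.
    rewrite /U (negPf vz) andbb /=; have [fa|] := eqVneq (f v) a; last by rewrite mul0r.
    by rewrite Ev // fa.
  case: (a == b); rewrite ?mulr0n ?mulr1n ?addr0 //.
  by rewrite -{1}(divff (E'_neq0 a)) -mulrDl /E' subrK.
rewrite det_diag_add_const => [|c]; last by rewrite mxE mulf_neq0 ?invr_eq0.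
under eq_bigr => i _ do rewrite mxE.
under [X in _ * (_ * (X * _))]eq_bigr => c _ do rewrite mxE.
under [X in _ * (_ * (_ * (_ + _ * X)))]eq_bigr => c _ do rewrite mxE invf_div.
rewrite -(big_enum_val (A := V) E) -(big_enum_val (A := T) (fun c => E' c / (x - 1))).
rewrite -(big_enum_val (A := T) (fun c => (x - 1) / E' c)) -mulr_suml /=.
(* Divided by [x - 1], the term in [#|T|] cancels the one in [E z]. *)
have -> : \sum_c E' c = #|T|%:R * (x - 1) - #|V|.-1%:R.
  rewrite sumrB sumr_const mulr_natl; congr (_ - _).
  by rewrite -natr_sum sum_class_sizes.
have -> : \prod_v E v = E z * \prod_c E' c ^+ s c.
  rewrite (bigD1 z) //=; congr (_ * _).
  rewrite (partition_big f predT) //=; apply: eq_bigr => c _.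
  rewrite /s -prodr_const; apply: eq_big => [v|v /andP[vz /eqP <-]]; first by rewrite inE.
  exact: Ev.
set S := \prod_(c | s c != 0%N) _.
(* Where [s c = 0], [E' c = x - 1] and the factor is 1; elsewhere one power of [E' c] cancels. *)
have defS : \prod_c E' c ^+ s c * \prod_c ((x - 1) / E' c) = S.
  rewrite -big_split [RHS]big_mkcond /=; apply: eq_bigr => c _.
  have [sc0|] := eqVneq (s c) 0%N.
    by rewrite sc0 expr0 mul1r /E' sc0 subr0 divff.
  rewrite -lt0n => sc_gt0.
  have -> : E' c ^+ s c = E' c ^+ (s c).-1 * E' c by rewrite -exprSr prednK.
  by rewrite -mulrA mulrC [E' c * _]mulrC divfK.
have defV : #|V|%:R = 1 + #|V|.-1%:R :> F.
  by rewrite -mulrS prednK //; apply/card_gt0P; exists z.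
rewrite -{}defS defV; move: (E_neq0 z); rewrite Ez => Ez_neq0.
by field; rewrite x1_neq0.
Qed.

End Fan.

(** The number of classes of size 2 is read off from the total size. *)
Lemma prod_two_sizes (R : comPzSemiRingType) (T : finType) (s : T -> nat) (g : nat -> R) c0 m n :
  s c0 = m -> m != 0%N -> (forall c, c != c0 -> s c != 0%N -> s c = 2) ->
  (\sum_c s c = m + 2 * n)%N ->
  \prod_(c | s c != 0%N) g (s c) = g m * g 2%N ^+ n.
Proof.
move=> sc0 m_neq0 s2; rewrite (bigD1 c0) //= sc0 => /addnI sum_s.
rewrite (bigD1 c0) ?sc0 //=; congr (_ * _).
rewrite (eq_bigr (fun=> g 2%N)) => [|c /andP[sc c_neq]]; last by rewrite s2.
rewrite prodr_const; congr (_ ^+ _); apply/eqP.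
rewrite -(eqn_pmul2l (isT : 0 < 2)%N) -sum_s mulnC -sum_nat_const; apply/eqP.
rewrite big_mkcond [RHS]big_mkcond; apply: eq_bigr => c _; rewrite unfold_in.
have [//|/s2 sc] := eqVneq c c0; first by rewrite andbF.
by have [->|/sc->] := eqVneq (s c) 0%N.
Qed.

(** * Distance Laplacian of a graph with a dominating vertex *)

Lemma rowsum_laplacian (V : finType) (e : rel V) i :
  \sum_j laplacian_mx e i j = 0.
Proof.
under eq_bigr do rewrite !mxE.
rewrite sumrB -(big_enum_val (A := V) (fun v => (e (enum_val i) v)%:R)) /=.
rewrite (bigD1 i) //= eqxx mulr1n big1 => [|j]; last by rewrite eq_sym => /negPf->.
rewrite addr0 /deg -sum1_card natr_sum big_mkcond -sumrB big1 // => v _.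
by rewrite inE; case: (e _ _); rewrite subrr.
Qed.

(** The walk [u, z, v] bounds the distance by 2. *)
Lemma gdist_dominated (V : finType) (e : rel V) z u v :
  (forall w, w != z -> e w z && e z w) ->
  gdist e u v = (if u == v then 0 else if e u v then 1 else 2)%N.
Proof.
move=> hub; have [<-|uv] := eqVneq u v.
  have [_ /(_ [::])] := gdistP (connect0 e u).
  by move=> /(_ isT erefl); case: gdist.
have conn p : path e u p -> last u p = v -> connect e u v.
  by move=> ep lp; apply/connectP; exists p.
case: ifPn => [euv | not_euv].
  have ep : path e u [:: v] by rewrite /= euv.
  have [[p [_ lp <-]] /(_ _ ep erefl)] := gdistP (conn _ ep erefl).
  by case: p lp => [/= uv'|? []//]; rewrite uv' eqxx in uv.
have uz : u != z by apply: contraNneq not_euv => uz; move: uv; rewrite uz eq_sym => /hub/andP[].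
have vz : v != z by apply: contraNneq not_euv => ->; case/andP: (hub _ uz).
have ep : path e u [:: z; v].
  by rewrite /= andbT; case/andP: (hub _ uz) => -> _; case/andP: (hub _ vz).
have [[p [ep' lp <-]] /(_ _ ep erefl)] := gdistP (conn _ ep erefl).
case: p ep' lp => [_ /= uv'|w [/= /andP[euw _] wv|w' []//]].
  by rewrite uv' eqxx in uv.
by rewrite wv (negPf not_euv) in euw.
Qed.

(** Distinct vertices are at distance 2, less 1 if adjacent, so the transmission of [u] is
    [2 * #|V| - 2 - deg e u]. *)
Lemma distance_laplacianE (V : finType) (e : rel V) z :
  irreflexive e -> (forall w, w != z -> e w z && e z w) ->
  distance_laplacian_mx e = (2 * #|V|)%:R%:M - const_mx 2%:R - laplacian_mx e.
Proof.
move=> irr hub; apply/matrixP=> i j; rewrite !mxE.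
rewrite (gdist_dominated _ _ hub) (inj_eq enum_val_inj).
have [<-|ij] := eqVneq i j; last by rewrite !mulr0n; case: (e _ _).
rewrite !mulr1n irr /=; set u := enum_val i.
have -> : (transmission e u)%:R = (2 * #|V|)%:R - 2%:R - (deg e u)%:R :> int.
  rewrite /transmission natr_sum.
  have -> : (deg e u)%:R = \sum_v (e u v)%:R :> int.
    rewrite /deg -sum1_card natr_sum big_mkcond; apply: eq_bigr => v _.
    by rewrite inE; case: (e _ _).
  have -> : (2 * #|V|)%:R = \sum_(v : V) 2%:R :> int.
    by rewrite sumr_const natrM mulr_natr.
  have two : 2%:R = \sum_(v : V) 2%:R *+ (u == v) :> int.
    by rewrite (bigD1 u) //= eqxx big1 ?addr0 // => v; rewrite eq_sym => /negPf->.
  rewrite [X in _ - X - _]two -!sumrB; apply: eq_bigr => v _; rewrite (gdist_dominated _ _ hub).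
  by have [<-|_] := eqVneq u v; [rewrite irr | case: (e _ _)].
by rewrite !subr0.
Qed.

(** Subtracting [2 J] contributes the factor [1 - 2 * #|V| / y = - x / y]; its sign joins the [#|V|]
    signs from negating the matrix. *)
Lemma det_distance_laplacian (V : finType) (e : rel V) z (F : fieldType) (x y : F) :
  irreflexive e -> (forall w, w != z -> e w z && e z w) ->
  y = (2 * #|V|)%:R - x -> y != 0 ->
  y * \det (x%:M - map_mx intr (distance_laplacian_mx e)) =
  (-1) ^+ #|V|.+1 * x * \det (y%:M - map_mx intr (laplacian_mx e)).
Proof.
move=> irr hub def_y y_neq0; rewrite (distance_laplacianE irr hub).
set L := laplacian_mx e.
(* [x - DL = - (y - L - 2 J)], and every row of [y - L] sums to [y]. *)
have -> : x%:M - map_mx intr ((2 * #|V|)%:R%:M - const_mx 2 - L) =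
    (-1) *: (y%:M - map_mx intr L - const_mx 2%:R) :> 'M[F]_#|V|.
  apply/matrixP=> i j; rewrite def_y !mxE.
  by case: (i == j); rewrite ?mulr1n ?mulr0n ?rmorphB ?rmorph_nat /=; ring.
rewrite detZ (@det_sub_const _ _ _ y) // => [|i].
  by rewrite exprS def_y natrM; field; rewrite -natrM -def_y.
under eq_bigr => j _ do rewrite !mxE.
rewrite sumrB -rmorph_sum (eq_bigr (fun j => L i j)) => [|j _]; last by rewrite !mxE.
rewrite rowsum_laplacian rmorph0 subr0 (bigD1 i) //= eqxx big1 ?addr0 // => j.
by rewrite eq_sym => /negPf->.
Qed.

(** * Characteristic polynomials in the fraction field *)

Lemma char_poly_subE (R : comNzRingType) m (M : 'M[R]_m) :
  char_poly_sub M = (-1) ^+ m * char_poly M.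
Proof. by rewrite /char_poly -detZ scaleN1r opprB. Qed.

Lemma tofrac_char_poly m (M : 'M[int]_m) :
  tofrac (char_poly M) = \det ((tofrac 'X)%:M - map_mx intr M : 'M[{fraction {poly int}}]_m).
Proof.
rewrite -det_map_mx; congr (\det _); apply/matrixP=> i j; rewrite !mxE.
rewrite rmorphB rmorphMn /=; congr (_ - _).
by rewrite -[M i j]intz !rmorph_int.
Qed.

Lemma tofracX_nonint (i : int) : tofrac 'X != i%:~R :> {fraction {poly int}}.
Proof.
rewrite -(rmorph_int (@tofrac {poly int})) tofrac_eq -(rmorph_int polyC) -subr_eq0.
by rewrite polyXsubC_eq0.
Qed.

End Determinants.

(** * Structure of the generalized quaternion group *)

Section QuaternionPowerGraph.

Local Open Scope group_scope.

(** The third relation amounts to [a ^ b = a^-1], so both groups have the same homomorphic images;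
    finite groups that are images of each other are isomorphic. *)
Lemma isog_quaternion k n (gT : finGroupType) (Q : {group gT}) :
  (1 <= k)%N -> n = (2 ^ k)%N ->
  Q \isog Grp (a : b : a ^+ (2 * n), b ^+ 2 = a ^+ n, a * b = b * a^-1) ->
  Q \isog 'Q_(2 ^ k.+2).
Proof.
move=> k_gt0 -> isoQ.
have k2 : (2 < k.+2)%N by [].
have homE rT (H : {group rT}) : (H \homg Q) = (H \homg 'Q_(2 ^ k.+2)).
  rewrite isoQ (Grp_quaternion k2) /= -expnS.
  apply: eq_existsb => -[x y] /=; rewrite !xpair_eqE.
  rewrite conjgE; congr [&& _, _, _ & _].
  by apply/eqP/eqP=> [->|<-]; rewrite ?mulKg ?mulVKg.
by rewrite isogEhom homE homg_refl -homE homg_refl.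
Qed.

(** The graph is computed from these facts; the presentation serves to obtain them. *)
Lemma quaternion_orders k n (gT : finGroupType) (Q : {group gT}) :
  (1 <= k)%N -> n = (2 ^ k)%N ->
  Q \isog Grp (a : b : a ^+ (2 * n), b ^+ 2 = a ^+ n, a * b = b * a^-1) ->
  exists a, [/\ #|Q| = (4 * n)%N, a \in Q, #[a] = (2 * n)%N,
    {in Q :\: <[a]>, forall t, #[t] = 4}
    & forall u, u \in Q -> #[u] = 2 -> u = a ^+ n].
Proof.
move=> k_gt0 def_n /(isog_quaternion k_gt0 def_n) isoQ.
have k2 : (2 < k.+2)%N by [].
have [[a b] genQ _] := generators_quaternion k2 isoQ.
have [[_ o4 _] _ [_ _ inv _ _] _ _] := quaternion_structure k2 genQ isoQ.
have [oQ Qa oa _] := genQ.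
by exists a; split; rewrite ?oQ ?oa ?def_n ?expnS ?mulnA //.
Qed.

Lemma pos_power_cycle (gT : finGroupType) (x y : gT) : pos_power x y = (y \in <[x]>).
Proof.
apply/pos_powerP/idP => [[i _ ->]|/cycleP[i ->]]; first exact: mem_cycle.
(* Adding [#[x]] makes the exponent positive without changing the power. *)
by exists (i + #[x])%N; rewrite ?addn_gt0 ?order_gt0 ?orbT // expgD expg_order mulg1.
Qed.

(** * Cliques of the proper power graph *)

Variables (gT : finGroupType) (Q : {group gT}) (n : nat) (a : gT).
Hypotheses (Qa : a \in Q) (oa : #[a] = (2 * n)%N) (n2 : 2.-nat n).
Hypothesis o4 : {in Q :\: <[a]>, forall t, #[t] = 4}.
Hypothesis invQ : forall u, u \in Q -> #[u] = 2 -> u = a ^+ n.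
Let z := a ^+ n.

(* [z] gets the value [<[a]>], although it belongs to every clique. *)
Definition clique_of (x : gT) : {set gT} := if x \in <[a]> then <[a]> else <[x]>.

Lemma order_z : #[z] = 2.
Proof. by case/andP: n2 => n_gt0 _; rewrite orderXdiv oa ?dvdn_mull // mulnK. Qed.

Lemma sqr_out t : t \in Q -> t \notin <[a]> -> t ^+ 2 = z.
Proof.
move=> Qt nAt; apply: invQ; first exact: groupX.
by rewrite orderXdiv o4 // inE nAt.
Qed.

(** A nontrivial element of [<[t]>] has order 2 or 4. Order 2 means [z]; order 4 would make [x] a
    generator and put [t] in [<[a]>]. *)
Lemma in_cycle_out x t : x \in Q^# -> x \in <[a]> -> t \in Q -> t \notin <[a]> ->
  (x \in <[t]>) = (x == z).
Proof.
move=> /setD1P[x_neq1 Qx] Ax Qt nAt; apply/idP/eqP=> [tx | ->]; last first.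
  by rewrite -(sqr_out Qt nAt) mem_cycle.
have ot : #[t] = 4 by rewrite o4 // inE nAt.
apply: invQ => //; have := order_dvdG tx; rewrite -orderE ot.
rewrite dvdn_divisors // !inE => /or3P[]/eqP ox //.
  by rewrite -order_eq1 ox in x_neq1.
have eq_xt : <[x]> = <[t]>.
  by apply/eqP; rewrite eqEcard cycle_subG tx -!orderE ox ot.
by rewrite -cycle_subG -eq_xt cycle_subG Ax in nAt.
Qed.

Lemma cycle_out x t : x \in Q -> x \notin <[a]> -> t \in Q -> t \notin <[a]> ->
  (x \in <[t]>) = (<[x]> == <[t]>).
Proof.
move=> Qx nAx Qt nAt; rewrite -cycle_subG; apply/idP/eqP=> [sxt|->//].
by apply/eqP; rewrite eqEcard sxt -!orderE !o4 // !inE ?nAx ?nAt.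
Qed.

(** The subgroups of a cyclic 2-group form a chain, being ordered by divisibility of their orders,
    which are powers of 2. *)
Lemma cycle_comparable x y : x \in <[a]> -> y \in <[a]> ->
  (x \in <[y]>) || (y \in <[x]>).
Proof.
wlog le_xy : x y / #[x] <= #[y] => [IH | Ax Ay].
  by move=> Ax Ay; case/orP: (leq_total #[x] #[y]) => /IH; [|rewrite orbC]; apply.
have pa : 2.-nat #[a] by rewrite oa pnatM.
have dvd_xy : #[x] %| #[y].
  move: (order_dvdG Ax) (order_dvdG Ay); rewrite -orderE.
  have [/= e ->] := p_natP pa.
  move=> /(dvdn_pfactor _ _ (isT : prime 2))[i _ ox].
  move=> /(dvdn_pfactor _ _ (isT : prime 2))[j _ oy].
  by move: le_xy; rewrite ox oy leq_exp2l // => /dvdn_exp2l->.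
by rewrite -!cycle_subG -(cardSg_cyclic (cycle_cyclic a)) ?cycle_subG // -!orderE dvd_xy.
Qed.

Lemma clique_of_in x : (clique_of x == <[a]>) = (x \in <[a]>).
Proof.
rewrite /clique_of; case: ifPn => [|nAx]; first by rewrite eqxx.
by apply: contraNF nAx => /eqP <-; apply: cycle_id.
Qed.

Lemma hub_in : z \in Q^#.
Proof. by rewrite 2!inE groupX // -order_eq1 order_z. Qed.

(** Within [<[a]>] any two elements are comparable; across its border only [z] is a power of the
    other element; outside, being a power means generating the same subgroup. *)
Lemma power_adj_clique_of x y : x \in Q^# -> y \in Q^# ->
  power_adj x y = (x != y) && [|| x == z, y == z | clique_of x == clique_of y].
Proof.
move=> Qx Qy; have [_ Gx] := setD1P Qx; have [_ Gy] := setD1P Qy.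
rewrite /power_adj !pos_power_cycle; have [//|/= xy] := eqVneq x y.
have Az : z \in <[a]> by apply: mem_cycle.
have zN t : t \notin <[a]> -> (t == z) = false by apply: contraNF => /eqP->.
have outside t w : t \in <[a]> -> w \notin <[a]> -> w \in <[t]> = false.
  by move=> At; apply: contraNF; apply: subsetP; rewrite cycle_subG.
have [Ax|nAx] := boolP (x \in <[a]>); have [Ay|nAy] := boolP (y \in <[a]>).
- by rewrite orbC cycle_comparable // /clique_of Ax Ay eqxx !orbT.
- rewrite outside // in_cycle_out // (zN y) //= /clique_of Ax (negPf nAy).
  have /negPf-> : <[a]> != <[y]>; last by rewrite orbF.
  by apply: contraNneq nAy => ->; apply: cycle_id.
- rewrite (outside y x) // orbF in_cycle_out // (zN x) //= /clique_of Ay (negPf nAx).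
  have /negPf-> : <[x]> != <[a]>; last by rewrite orbF.
  by apply: contraNneq nAx => <-; apply: cycle_id.
rewrite (cycle_out Gx nAx Gy nAy) (cycle_out Gy nAy Gx nAx) (zN x) // (zN y) //=.
by rewrite /clique_of (negPf nAx) (negPf nAy) [<[y]> == _]eq_sym orbb.
Qed.

Lemma card_clique_of_in : #|[set x in Q^# | (x != z) && (clique_of x == <[a]>)]| = (2 * n - 2)%N.
Proof.
have -> : [set x in Q^# | (x != z) && (clique_of x == <[a]>)] = <[a]> :\ 1 :\ z.
  apply/setP=> x; rewrite !inE clique_of_in; case Ax: (x \in <[a]>); rewrite ?andbF //.
  have -> : x \in Q by apply: subsetP Ax; rewrite cycle_subG.
  by rewrite !andbT andbC.
have := cardsD1 1 <[a]>; rewrite group1 -orderE oa.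
have := cardsD1 z (<[a]> :\ 1).
rewrite !inE mem_cycle -order_eq1 order_z /= => -> ->.
by rewrite addnA addKn.
Qed.

(** The class of [t] consists of the generators of [<[t]>], and [totient 4 = 2]. *)
Lemma card_clique_of_out c : c != <[a]> ->
  #|[set x in Q^# | (x != z) && (clique_of x == c)]| != 0%N ->
  #|[set x in Q^# | (x != z) && (clique_of x == c)]| = 2.
Proof.
move=> c_neq; rewrite cards_eq0 => /set0Pn[t]; rewrite inE => /and3P[Qt tz /eqP def_c].
have nAt : t \notin <[a]> by rewrite -clique_of_in def_c.
have [_ Gt] := setD1P Qt.
rewrite /clique_of (negPf nAt) in def_c; rewrite -{c}def_c in c_neq *.
have <- : totient #[t] = 2 by rewrite o4 // inE nAt.
rewrite totient_gen; congr #|pred_of_set _|; apply/setP=> x; rewrite !inE.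
apply/and3P/idP => [[/andP[_ Gx] xz]|gen_x].
  rewrite /clique_of; case: ifPn => [_|nAx]; last by rewrite /generator eq_sym.
  by rewrite eq_sym (negPf c_neq).
have tx : <[t]> = <[x]> by apply/eqP.
have nAx : x \notin <[a]> by rewrite -cycle_subG -tx cycle_subG.
have Gx : x \in Q by rewrite -cycle_subG -tx cycle_subG.
split; last by rewrite /clique_of (negPf nAx) tx.
  by rewrite Gx andbT; apply: contraNneq nAx => ->.
by apply: contraNneq nAx => ->; apply: mem_cycle.
Qed.

Let V := {x : gT | x \in Q^#}.
Let hub : V := exist _ z hub_in.

Lemma proper_power_graphE (u v : V) :
  proper_power_graph Q u v =
    (u != v) && [|| u == hub, v == hub | clique_of (val u) == clique_of (val v)].
Proof. by rewrite /proper_power_graph /induced power_adj_clique_of ?(valP u) ?(valP v). Qed.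

Lemma card_clique_of c :
  #|[set v : V | (v != hub) && (clique_of (val v) == c)]| =
  #|[set x in Q^# | (x != z) && (clique_of x == c)]|.
Proof.
rewrite -(card_imset _ val_inj); congr #|pred_of_set _|; apply/setP=> x.
apply/imsetP/idP => [[v] | ]; first by rewrite !inE => vP ->; move: (valP v); rewrite !inE => ->.
rewrite inE => /andP[Qx xP]; exists (exist _ x Qx : V) => //.
by rewrite inE.
Qed.

(* The two characteristic polynomials of the quaternion graph *)
Local Close Scope group_scope.
Local Open Scope ring_scope.

Hypotheses (oQ : #|Q| = (4 * n)%N) (n_gt1 : (1 < n)%N).

Lemma card_vertices : #|{: V}| = (4 * n - 1)%N.
Proof. by rewrite card_sig -oQ (cardsD1 1%g Q) group1 addKn. Qed.

(** The clique from [<[a]>] has [2 * n - 2] vertices off [z], which leaves [n] pairs among the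
    [4 * n - 2] vertices other than [z]. *)
Lemma det_quaternion_laplacian (F : fieldType) (x : F) :
  (forall i : int, x != i%:~R) ->
  \det (x%:M - map_mx intr (laplacian_mx (proper_power_graph Q))) =
  x * (x - (4 * n)%:R + 1) * (x - (2 * n)%:R + 1) ^+ (2 * n - 3)
    * ((x - 1) * (x - 3%:R)) ^+ n.
Proof.
move=> x_nonint; have x1_neq0 : x - 1 != 0 by rewrite subr_eq0; apply: (x_nonint 1).
apply: (mulfI x1_neq0).
rewrite (det_fan_laplacian proper_power_graphE x_nonint) card_vertices.
rewrite (@prod_two_sizes _ _ _ (fun m => (x - 1) * (x - 1 - m%:R) ^+ m.-1)
  <[a]>%g (2 * n - 2)%N n).
- rewrite -subnS expr1 !natrB; [|lia..].
  have -> : x - 1 - ((2 * n)%:R - 2%:R) = x - (2 * n)%:R + 1 by ring.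
  have -> : x - 1 - 2%:R = x - 3%:R by ring.
  ring.
- by rewrite card_clique_of card_clique_of_in.
- lia.
- by move=> c; rewrite card_clique_of; apply: card_clique_of_out.
by rewrite sum_class_sizes card_vertices; lia.
Qed.

(** The reflection of [t] to [8 * n - 2 - t] fixes [4 * n - 1] and sends the Laplacian eigenvalues
    [2 * n - 1], 1 and 3 to [6 * n - 1], [8 * n - 3] and [8 * n - 5]. *)
Lemma det_quaternion_distance_laplacian (F : fieldType) (x : F) :
  (forall i : int, x != i%:~R) ->
  \det (x%:M - map_mx intr (distance_laplacian_mx (proper_power_graph Q))) =
  x * (x - (4 * n)%:R + 1) * (x - (6 * n)%:R + 1) ^+ (2 * n - 3)
    * ((x - (8 * n)%:R + 5%:R) * (x - (8 * n)%:R + 3%:R)) ^+ n.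
Proof.
move=> x_nonint; pose y := (2 * #|{: V}|)%:R - x.
have y_nonint (i : int) : y != i%:~R.
  have := x_nonint ((2 * #|{: V}|)%:R - i); apply: contraNneq => yi.
  by rewrite rmorphB rmorph_nat /= -yi /y opprB addrC subrK.
have y_neq0 : y != 0 := y_nonint 0.
have irr : irreflexive (proper_power_graph Q).
  by move=> u; rewrite proper_power_graphE eqxx.
have hub_adj u : u != hub -> proper_power_graph Q u hub && proper_power_graph Q hub u.
  by move=> u_hub; rewrite !proper_power_graphE [hub == u]eq_sym u_hub !eqxx orbT.
apply: (mulfI y_neq0).
rewrite (det_distance_laplacian irr hub_adj (erefl y) y_neq0).
rewrite det_quaternion_laplacian //.
have def_y : y = (8 * n)%:R - 2%:R - x.
  rewrite /y card_vertices; congr (_ - _).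
  by rewrite -natrB; [congr (_%:R); lia | lia].
have -> : y - (4 * n)%:R + 1 = - (x - (4 * n)%:R + 1) by rewrite def_y; ring.
have -> : y - (2 * n)%:R + 1 = - (x - (6 * n)%:R + 1) by rewrite def_y; ring.
have -> : (y - 1) * (y - 3%:R) = (x - (8 * n)%:R + 5%:R) * (x - (8 * n)%:R + 3%:R).
  by rewrite def_y; ring.
(* The exponent is [4 * n], hence even; the odd power [2 * n - 3] below yields a sign that cancels
   the one of the factor [x - (4 * n)%:R + 1]. *)
have -> : (-1) ^+ #|{: V}|.+1 = 1 :> F.
  by rewrite -signr_odd card_vertices (_ : odd _ = false) //; lia.
have signE : (-1) ^+ (2 * n - 3) = -1 :> F.
  by rewrite -signr_odd (_ : odd _ = true) //; lia.
by rewrite exprNn signE; ring.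
Qed.

End QuaternionPowerGraph.

Local Open Scope ring_scope.

Theorem theorem3p5 (k n : nat) (hk : (1 <= k)%N) (hn : n = (2 ^ k)%N)
    (gT : finGroupType) (Q : {group gT})
    (hQ : (Q \isog Grp (a : b :
             (a ^+ (2 * n), b ^+ 2 = a ^+ n, a * b = b * a^-1)))%g) :
  let L := laplacian_mx (proper_power_graph Q) in
  let DL := distance_laplacian_mx (proper_power_graph Q) in
  let pDL : {poly int} :=
    'X * ('X - (4 * n)%:R + 1) * ('X - (6 * n)%:R + 1) ^+ (2 * n - 3)
       * ('X - (8 * n)%:R + 5%:R) ^+ n * ('X - (8 * n)%:R + 3%:R) ^+ n in
  let pL : {poly int} :=
    'X * ('X - 3%:R) ^+ n * ('X - 1) ^+ n * ('X - (4 * n)%:R + 1)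
       * ('X - (2 * n)%:R + 1) ^+ (2 * n - 3) in
  (char_poly_sub DL = (-1) ^+ (4 * n - 1) * pDL /\ char_poly DL = pDL) /\
  (char_poly_sub L = (-1) ^+ (4 * n - 1) * pL /\ char_poly L = pL).
Proof.
move=> L DL pDL pL.
have [a [oQ Qa oa o4 invQ]] := quaternion_orders hk hn hQ.
have n2 : 2%N.-nat n by rewrite hn pnatX.
have n_gt1 : (1 < n)%N by rewrite hn -{1}(expn0 2) ltn_exp2l.
(* As [tofrac] is injective, comparing images in the fraction field suffices, with the indeterminate
   as the non-integer [x]. *)
have charL : char_poly L = pL.
  apply/eqP; rewrite -tofrac_eq tofrac_char_poly.
  rewrite (det_quaternion_laplacian Qa oa n2 o4 invQ oQ n_gt1 tofracX_nonint).
  rewrite /pL !(rmorphM, rmorphXn, rmorphD, rmorphN, rmorph1, rmorph_nat) /=.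
  by apply/eqP; rewrite exprMn; ring.
have charDL : char_poly DL = pDL.
  apply/eqP; rewrite -tofrac_eq tofrac_char_poly.
  rewrite (det_quaternion_distance_laplacian Qa oa n2 o4 invQ oQ n_gt1 tofracX_nonint).
  rewrite /pDL !(rmorphM, rmorphXn, rmorphD, rmorphN, rmorph1, rmorph_nat) /=.
  by apply/eqP; rewrite exprMn; ring.
by rewrite !char_poly_subE charL charDL !(card_vertices oQ).
Qed.
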